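(* Let $n\ge m\ge 3$ be integers. Then $$ex(n,m;\mathbb{T}_{3,3})=\begin{cases}2(n+m)-8, & \text{if } n\ge 5 \text{ and } m\ge 5;\\ 9, & \text{if } n=m=4;\\ 2n, & \text{otherwise.}\end{cases}$$
   Context: All graphs are finite, simple and undirected. An $(n,m)$-bipartite graph $G[U,V;E]$ is a bipartite graph whose vertex set is the disjoint union of $U$ and $V$ with $|U|=n$, $|V|=m$, every edge joining a vertex of $U$ to a vertex of $V$. $\mathbb{T}_{3,3}$ is the set of all trees of order $6$ whose two colour classes both have size $3$. A graph $G$ contains a tree $T$ as a subgraph if there is an injection $f:V(T)\to V(G)$ with $f(x)f(y)\in E(G)$ whenever $xy\in E(T)$. $ex(n,m;\mathbb{T}_{3,3})$ is the maximum number of edges of an $(n,m)$-bipartite graph that does not contain all trees of $\mathbb{T}_{3,3}$ as subgraphs, i.e. that fails to contain at least one tree of $\mathbb{T}_{3,3}$. *)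

(* Defs.v *)
From mathcomp Require Import all_boot.

Set Implicit Arguments.
Unset Strict Implicit.
Unset Printing Implicit Defensive.

Record sgraph := SGraph {
  vertex :> finType;
  edge : rel vertex;
  edge_sym : symmetric edge;
  edge_irr : irreflexive edge }.

Definition edges (G : sgraph) : {set {set G}} :=
  [set e | [exists x, exists y, edge x y && (e == [set x; y])]].

Definition connected (G : sgraph) : Prop :=
  0 < #|G| /\ forall x y : G, connect (@edge G) x y.

(* The bound on the size of [c] matters: [ucycle] also accepts the empty
   sequence and the back-and-forth walk [:: x; y] along one edge. *)
Definition acyclic (G : sgraph) : Prop :=
  forall c : seq G, 2 < size c -> ~ ucycle (@edge G) c.

Definition tree (G : sgraph) : Prop := connected G /\ acyclic G.

Definition bipartition (G : sgraph) (U V : {set G}) : Prop :=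
  [/\ U :|: V = [set: G], [disjoint U & V]
    & forall x y : G, edge x y ->
        (x \in U /\ y \in V) \/ (x \in V /\ y \in U)].

Definition bipartite_graph (n m : nat) (G : sgraph) : Prop :=
  exists U V : {set G}, [/\ bipartition U V, #|U| = n & #|V| = m].

Definition T33 (T : sgraph) : Prop :=
  [/\ tree T, #|T| = 6
    & exists U V : {set T}, [/\ bipartition U V, #|U| = 3 & #|V| = 3]].

Definition contains (G T : sgraph) : Prop :=
  exists f : T -> G,
    injective f /\ forall x y : T, edge x y -> edge (f x) (f y).

Definition contains_all_T33 (G : sgraph) : Prop :=
  forall T : sgraph, T33 T -> contains G T.

(* [is_ex n m k] reads "ex(n, m; T_{3,3}) = k": the maximum exists and is [k].
   A relation is used so that no default value for an empty maximum appears. *)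
Definition is_ex (n m k : nat) : Prop :=
  (exists G : sgraph,
      [/\ bipartite_graph n m G, ~ contains_all_T33 G & #|edges G| = k]) /\
  (forall G : sgraph,
      bipartite_graph n m G -> ~ contains_all_T33 G -> #|edges G| <= k).

(* Main.v *)
(** T_{3,3} consists of the path P_6, the double star S(2,2) and the spider with
legs 2, 2, 1: every 3 x 3 bipartite graph without a 4- or a 6-cycle is
contained in one of these.

Upper bound. A graph with minimum degree 3 contains P_6 and the spider greedily.
Deleting a vertex of degree at most 2 lowers the bound 2(n+m)-8 by exactly 2, so
for these two trees it remains to treat a side of size 3 or 4; averaging over
the other side reduces this to 3 x 3 graphs with at least 7 edges and 4 x 4
graphs with at least 9 edges, which are enumerated. For the double star, which
has the exceptional value 9 when n = m = 4, deletion fails; but a graph without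
it has no edge between two vertices of degree at least 3, and this bounds its
edges directly.

Lower bound. The graphs K_{2,m-2} + K_{n-2,2}, K_{n,2} + isolated vertices, and
(for n = m = 4) two disjoint claws K_{1,3} whose leaves are joined by a perfect
matching have an end of degree at most 2 on every edge, hence no double star. *)

Require Import Defs.
From mathcomp Require Import all_boot zify.

Set Implicit Arguments.
Unset Strict Implicit.
Unset Printing Implicit Defensive.

(* A relation [p] on [{0, 1, 2}] stands for the bipartite graph in which the
   [i]-th vertex of the first class is joined to the [j]-th of the second. *)
Definition path6 (i j : nat) := (i == j) || (i == j.+1).
Definition double_star (i j : nat) := (i == 0) || (j == 0).
Definition spider (i j : nat) := (i == 0) || (i == j.+1).
Definition cycle4 (i j : nat) := (i < 2) && (j < 2).
Definition cycle6 (i j : nat) := path6 i j || (i == 0) && (j == 2).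
Definition flip (p : rel nat) : rel nat := fun i j => p j i.

(** * Exhaustive search over small 0-1 matrices *)

Fixpoint words (T : Type) (k : nat) (s : seq T) : seq (seq T) :=
  if k is k'.+1 then [seq x :: w | x <- s, w <- words k' s] else [:: [::]].

Lemma mem_words (T : eqType) k (s w : seq T) :
  size w = k -> all [in s] w -> w \in words k s.
Proof.
elim: k w => [|k IH] [|x w] //= [sz_w] /andP[xs ws].
by apply: allpairs_f => //; apply: IH.
Qed.

Definition matrices k : seq (seq bitseq) := words k (words k [:: true; false]).

Definition entry (M : seq bitseq) i j := nth false (nth [::] M i) j.

Definition weight (M : seq bitseq) := sumn [seq count id r | r <- M].

Definition cells (p : rel nat) : seq (nat * nat) :=
  [seq ij <- [seq (i, j) | i <- iota 0 3, j <- iota 0 3] | p ij.1 ij.2].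

Lemma all_cells (p : rel nat) (Q : nat -> nat -> bool) :
  all (fun ij => Q ij.1 ij.2) (cells p) ->
  forall i j, i < 3 -> j < 3 -> p i j -> Q i j.
Proof.
move=> /allP H i j i3 j3 pij; apply: (H (i, j)).
by rewrite mem_filter pij; apply: allpairs_f; rewrite mem_iota.
Qed.

Definition relabelled k (P : rel (seq nat)) :=
  let js := permutations (iota 0 k) in has (fun s => has (P s) js) js.

Lemma relabelledP k P : relabelled k P ->
  exists s t, [/\ perm_eq s (iota 0 k), perm_eq t (iota 0 k) & P s t].
Proof.
move=> /hasP[s]; rewrite mem_permutations => ps /hasP[t].
by rewrite mem_permutations => pt Pst; exists s, t.
Qed.

(** Only the first three entries of [s] and [t] are read, so for [k = 4] all ordered choices of
    three rows and three columns are tried. *)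
Definition occurs (p : rel nat) k M :=
  let c := cells p in relabelled k (fun s t =>
    all (fun ij => entry M (nth 0 s ij.1) (nth 0 t ij.2)) c).

(** The inclusion opposite to [occurs]: after relabelling, every 1 of the 3 x 3 matrix lies in a
    cell of [p]. *)
Definition fits (p : rel nat) M :=
  let c := cells (fun i j => ~~ p i j) in relabelled 3 (fun s t =>
    all (fun ij => ~~ entry M (nth 0 s ij.1) (nth 0 t ij.2)) c).

Fixpoint descending c k w : seq (seq bitseq) :=
  if k is k'.+1 then
    [seq r :: M | r <- [seq r <- words c [:: true; false] | count id r <= w],
                  M <- descending c k' (count id r)]
  else [:: [::]].

Lemma mem_descending c w (M : seq bitseq) :
  all (fun r => size r == c) M -> path geq w [seq count id r | r <- M] ->
  M \in descending c (size M) w.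
Proof.
elim: M w => [|r M IH] w //= /andP[/eqP sz_r szM] /andP[rw rM].
apply: allpairs_f_dep; last exact: IH.
by rewrite mem_filter rw mem_words //; apply/allP => -[].
Qed.

(* Up to the order of the rows and columns, a matrix has rows of decreasing
   weight and a first row of the form 1...10...0; without this reduction there
   are too many 4 x 4 matrices to evaluate the checks below. *)
Definition normal k : seq (seq bitseq) :=
  [seq (nseq w true ++ nseq (k - w) false) :: M
     | w <- iota 0 k.+1, M <- descending k k.-1 w].

Definition path6_check k :=
  all (fun M => (2 * k < weight M) ==> occurs path6 k M) (normal k).

(** Unlike the path, the spider is not isomorphic to its flip: its vertex of degree 3 may lie in
    either class. *)
Definition spider_check k :=
  all (fun M => (2 * k < weight M) ==>
         occurs spider k M || occurs (flip spider) k M) (normal k).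

Lemma path6_check3 : path6_check 3. Proof. by lazy. Qed.

Lemma path6_check4 : path6_check 4. Proof. by lazy. Qed.

Lemma spider_check3 : spider_check 3. Proof. by lazy. Qed.

Lemma spider_check4 : spider_check 4. Proof. by lazy. Qed.

(** For a tree the two cycles are excluded, so it is a subgraph of one of the three patterns: this
    classifies the trees of T_{3,3}. *)
Lemma fits_check : all (fun M =>
  [|| occurs cycle4 3 M, occurs cycle6 3 M, fits path6 M, fits double_star M,
      fits spider M | fits (flip spider) M]) (matrices 3).
Proof. by lazy. Qed.

Definition adjacency (T : Type) (e : rel T) (A B : seq T) : seq bitseq :=
  [seq [seq e x y | y <- B] | x <- A].

Lemma entry_adjacency T (e : rel T) x0 A B i j : i < size A -> j < size B ->
  entry (adjacency e A B) i j = e (nth x0 A i) (nth x0 B j).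
Proof.
by move=> iA jB; rewrite /entry (nth_map x0) // (nth_map x0).
Qed.

Lemma mem_matrices (T : eqType) (e : rel T) A B k : size A = k -> size B = k ->
  adjacency e A B \in matrices k.
Proof.
move=> szA szB; apply: mem_words; first by rewrite size_map.
apply/allP => _ /mapP[x _ ->]; apply: mem_words; first by rewrite size_map.
by apply/allP => -[].
Qed.

(** * Six-vertex patterns in graphs *)

(** Only the values of [a] and [b] at 0, 1, 2 count. No bipartition is fixed, so for symmetric [e] a
    pattern and its flip are interchangeable. *)
Definition hosts (T : eqType) (e : rel T) (p : rel nat) :=
  exists a b : nat -> T, uniq (mkseq a 3 ++ mkseq b 3) /\
    forall i j, i < 3 -> j < 3 -> p i j -> e (a i) (b j).

Lemma hosts_flip (T : eqType) (e : rel T) p :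
  symmetric e -> hosts e (flip p) -> hosts e p.
Proof.
move=> e_sym [a [b [u H]]]; exists b, a; split; first by rewrite uniq_catC.
by move=> i j i3 j3 pij; rewrite e_sym; apply: H.
Qed.

Lemma relabel_lt k s i : perm_eq s (iota 0 k) -> i < k -> nth 0 s i < k.
Proof.
move=> ps ik; have sz_s : size s = k by rewrite (perm_size ps) size_iota.
have: nth 0 s i \in s by rewrite mem_nth ?sz_s.
by rewrite (perm_mem ps) mem_iota.
Qed.

Lemma relabel_uniq (T : eqType) (A B : seq T) x0 k s t :
    2 < k -> uniq (A ++ B) -> size A = k -> size B = k ->
    perm_eq s (iota 0 k) -> perm_eq t (iota 0 k) ->
  uniq (mkseq (fun i => nth x0 A (nth 0 s i)) 3 ++
        mkseq (fun i => nth x0 B (nth 0 t i)) 3).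
Proof.
move=> k3; rewrite cat_uniq => /and3P[uA /hasPn dAB uB] szA szB ps pt.
have inj C r : uniq C -> size C = k -> perm_eq r (iota 0 k) ->
    uniq (mkseq (fun i => nth x0 C (nth 0 r i)) 3).
  move=> uC szC pr; apply/mkseq_uniqP => i j /= i3 j3 /eqP.
  have ik := leq_trans i3 k3; have jk := leq_trans j3 k3.
  have szr : size r = k by rewrite (perm_size pr) size_iota.
  by rewrite !nth_uniq ?szC ?szr ?relabel_lt ?(perm_uniq pr) ?iota_uniq // =>
    /eqP.
rewrite cat_uniq !inj // andbT; apply/hasPn => _ /mapP[j + ->].
rewrite mem_iota => /andP[_ j3].
have jk := leq_trans j3 k3; apply/negP => /mapP[i + eq_ij].
rewrite mem_iota => /andP[_ i3].
have /dAB/negP[] : nth x0 B (nth 0 t j) \in B.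
  by rewrite mem_nth ?szB ?relabel_lt.
by rewrite /= eq_ij mem_nth ?szA ?relabel_lt // (leq_trans i3).
Qed.

Lemma occurs_hosts (T : eqType) (e : rel T) (A B : seq T) k p :
    2 < k -> uniq (A ++ B) -> size A = k -> size B = k ->
  occurs p k (adjacency e A B) -> hosts e p.
Proof.
move=> k3 uAB szA szB /relabelledP[s [t [ps pt]]].
move=> /(all_cells (Q := fun i j => entry _ (nth 0 s i) (nth 0 t j))) H.
have x0 : T by case: A szA k3 {uAB H} => [<-|].
exists (fun i => nth x0 A (nth 0 s i)), (fun j => nth x0 B (nth 0 t j)).
split; first exact: (@relabel_uniq _ _ _ _ k).
move=> i j i3 j3 /(H i j i3 j3); rewrite (entry_adjacency _ x0) ?szA ?szB //;
  by apply: relabel_lt => //; apply: leq_trans k3.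
Qed.

(** [T] is a spanning subgraph of the pattern; this inclusion lets a copy of [p] in a graph restrict
    to a copy of [T]. *)
Definition fitted (T : sgraph) (p : rel nat) :=
  exists a b : nat -> T, let s := mkseq a 3 ++ mkseq b 3 in
    [/\ uniq s, forall x, x \in s
      & forall x y, edge x y -> exists i j, [/\ i < 3, j < 3, p i j
          & (x = a i /\ y = b j) \/ (x = b j /\ y = a i)]].

Lemma fitted_flip (T : sgraph) p : fitted T (flip p) -> fitted T p.
Proof.
move=> [a [b [u H E]]]; exists b, a; split; first by rewrite uniq_catC.
  by move=> x; rewrite mem_cat orbC -mem_cat.
by move=> x y /E[i [j [i3 j3 pij xy]]]; exists j, i; split=> //; case: xy; auto.
Qed.

Lemma fitted_contains (G T : sgraph) p :
  fitted T p -> hosts (@edge G) p -> contains G T.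
Proof.
move=> [a [b [us cov E]]] [c [d [ut H]]].
(* Each vertex of [T] goes to the vertex of [G] in the same position of the six-element lists; the
   default [c 0] is never reached. *)
pose f x := nth (c 0) (mkseq c 3 ++ mkseq d 3) (index x (mkseq a 3 ++ mkseq b 3)).
have idx x : index x (mkseq a 3 ++ mkseq b 3) < 6.
  by have := cov x; rewrite -index_mem size_cat !size_mkseq.
have fa i : i < 3 -> f (a i) = c i.
  move=> i3; rewrite /f index_cat.
  have -> : a i \in mkseq a 3 by apply: map_f; rewrite mem_iota.
  move: us; rewrite cat_uniq => /and3P[ua _ _].
  have := index_uniq (a 0) _ ua; rewrite size_mkseq => /(_ i i3).
  by rewrite nth_mkseq // => ->; rewrite nth_cat size_mkseq i3 nth_mkseq.
have fb i : i < 3 -> f (b i) = d i.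
  move=> i3; rewrite /f index_cat.
  move: us; rewrite cat_uniq => /and3P[_ /hasPn dab ub].
  have bi : b i \in mkseq b 3 by apply: map_f; rewrite mem_iota.
  rewrite (negbTE (dab _ bi)).
  have := index_uniq (b 0) _ ub; rewrite size_mkseq => /(_ i i3).
  rewrite nth_mkseq // => ->.
  by rewrite nth_cat size_mkseq ltnNge leq_addr addKn; apply: nth_mkseq.
exists f; split=> [x y /eqP|x y /E[i [j [i3 j3 pij]]]].
  rewrite /f nth_uniq ?size_cat ?size_mkseq // => /eqP eq_xy.
  by rewrite -(nth_index x (cov x)) eq_xy nth_index.
by case=> -[-> ->]; rewrite fa // fb // ?[edge (d _) _]edge_sym; apply: H.
Qed.

Lemma T33_fitted (T : sgraph) : T33 T ->
  [\/ fitted T path6, fitted T double_star | fitted T spider].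
Proof.
move=> [[_ acT] _ [U [V [[cov disj bip] szU szV]]]].
have szU' : size (enum U) = 3 by rewrite -cardE.
have szV' : size (enum V) = 3 by rewrite -cardE.
have uUV : uniq (enum U ++ enum V).
  rewrite cat_uniq !enum_uniq /= andbT; apply/hasPn => x.
  by rewrite !mem_enum => xV; apply: contraTN disj => xU; apply/pred0Pn;
    exists x; apply/andP.
have [x0 _] : exists x0, x0 \in U by apply/card_gt0P; rewrite szU.
have fit p : fits p (adjacency (@edge T) (enum U) (enum V)) -> fitted T p.
  move=> /relabelledP[s [t [ps pt]]].
  move=> /(all_cells (Q := fun i j =>
    ~~ entry _ (nth 0 s i) (nth 0 t j))) H.
  pose a i := nth x0 (enum U) (nth 0 s i); pose b i := nth x0 (enum V) (nth 0 t i).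
  (* A relabelling permutes the class, so its three values exhaust it. *)
  have onto (W : {set T}) (r : seq nat) x : size (enum W) = 3 ->
      perm_eq r (iota 0 3) -> x \in W ->
      exists2 i, i < 3 & x = nth x0 (enum W) (nth 0 r i).
    move=> szW pr; rewrite -mem_enum => xW.
    have: index x (enum W) \in r by rewrite (perm_mem pr) mem_iota -szW index_mem.
    move/(nthP 0)=> [i]; rewrite (perm_size pr) => i3 def_i.
    by exists i; rewrite // def_i nth_index.
  exists a, b; split; first exact: (@relabel_uniq _ _ _ _ 3).
    move=> x; rewrite mem_cat; have := in_setT x; rewrite -cov inE.
    case/orP=> [/(onto U s _ szU' ps)|/(onto V t _ szV' pt)] [i i3 ->].
      by apply/orP; left; apply/mapP; exists i; rewrite // mem_iota.
    by apply/orP; right; apply/mapP; exists i; rewrite // mem_iota.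
  have cell i j : i < 3 -> j < 3 -> edge (a i) (b j) -> p i j.
    move=> i3 j3 eij; apply: contraLR eij => npij; have := H i j i3 j3 npij.
    by rewrite (entry_adjacency _ x0) ?szU' ?szV' ?relabel_lt.
  move=> x y exy; case: (bip x y exy) => -[].
    move=> /(onto U s _ szU' ps)[i i3 xE] /(onto V t _ szV' pt)[j j3 yE].
    exists i, j; split=> //; last by left.
    by apply: cell => //; rewrite /a /b -xE -yE.
  move=> /(onto V t _ szV' pt)[j j3 xE] /(onto U s _ szU' ps)[i i3 yE].
  exists i, j; split=> //; last by right.
  by apply: cell => //; rewrite /a /b -xE -yE edge_sym.
have := allP fits_check _ (mem_matrices (@edge T) szU' szV').
case/or4P=> [/occurs_hosts H|/occurs_hosts H|/fit H|].
- have [//|a [b [u {}H]]] := H _ uUV szU' szV'.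
  case: (acT [:: a 0; b 0; a 1; b 1]) => //.
  apply/andP; split; first by rewrite /= (edge_sym (b 0)) (edge_sym (b 1)) !H.
  (* The mask drops [a 2] and, being one entry short, also [b 2]; the four vertices of the cycle
     remain. *)
  have := subseq_uniq (mask_subseq [:: true; true; false; true; true] _) u.
  rewrite -(perm_uniq (s1 := [:: a 0; b 0; a 1; b 1])) //.
  by apply/permP => P /=; lia.
- have [//|a [b [u {}H]]] := H _ uUV szU' szV'.
  case: (acT [:: a 0; b 0; a 1; b 1; a 2; b 2]) => //.
  apply/andP; split.
    by rewrite /= (edge_sym (b 0)) (edge_sym (b 1)) (edge_sym (b 2)) !H.
  by rewrite -(@perm_uniq _ (mkseq a 3 ++ mkseq b 3)) //; apply/permP => P /=; lia.
- by constructor 1.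
- by case/or3P=> [/fit|/fit|/fit/fitted_flip]; [constructor 2|constructor 3..].
Qed.

(** * Edge counts forcing a pattern *)

Section Dense.

Variables (T : finType) (e : rel T).
Hypothesis e_sym : symmetric e.

Definition degree (X : {set T}) x := \sum_(y in X) e x y.

Definition between (A B : {set T}) := \sum_(x in A) degree B x.

Lemma between_sym (A B : {set T}) : between A B = between B A.
Proof.
rewrite /between /degree exchange_big; apply: eq_bigr => y _.
by apply: eq_bigr => x _; rewrite e_sym.
Qed.

Lemma between_del (A B : {set T}) x :
  x \in A -> between A B = degree B x + between (A :\ x) B.
Proof. by move=> xA; rewrite /between (big_setD1 x). Qed.

Lemma degree_card (X : {set T}) x : degree X x <= #|X|.
Proof. by rewrite -sum1_card; apply: leq_sum => y _; case: (e x y). Qed.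

Lemma between_le (A B : {set T}) k :
  {in A, forall x, degree B x <= k} -> between A B <= #|A| * k.
Proof. by move=> H; rewrite -sum_nat_const; apply: leq_sum. Qed.

Lemma between_ge (A B : {set T}) k :
  {in A, forall x, k <= degree B x} -> #|A| * k <= between A B.
Proof. by move=> H; rewrite -sum_nat_const; apply: leq_sum. Qed.

Lemma degree_perm (B : {set T}) sb x :
  perm_eq sb (enum B) -> count id [seq e x y | y <- sb] = degree B x.
Proof.
move=> pB; rewrite count_map (permP pB) -sum1_count big_mkcond /degree -big_enum.
by apply: eq_bigr => y _ /=; case: (e x y).
Qed.

Lemma weight_adjacency (A B : {set T}) sa sb :
  perm_eq sa (enum A) -> perm_eq sb (enum B) ->
  weight (adjacency e sa sb) = between A B.
Proof.
move=> pA pB; rewrite /weight sumnE !big_map (perm_big _ pA) big_enum /=.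
by apply: eq_bigr => x _; apply: degree_perm.
Qed.

(** Sort [A] by decreasing degree, then list the neighbours of its first vertex first in [B];
    permuting columns leaves the row weights unchanged. *)
Lemma normal_adjacency (A B : {set T}) k : 0 < k -> #|A| = k -> #|B| = k ->
  exists sa sb, [/\ perm_eq sa (enum A), perm_eq sb (enum B)
    & adjacency e sa sb \in normal k].
Proof.
move=> k_gt0 szA szB; pose sa := sort (relpre (degree B) geq) (enum A).
have pA : perm_eq sa (enum A) by rewrite perm_sort.
have : sorted (relpre (degree B) geq) sa.
  by apply: sort_sorted => x y; apply: leq_total.
have : size sa = k by rewrite size_sort -cardE.
case: sa pA => [|x sa] pA; first by move=> k0; rewrite -k0 in k_gt0.
move=> sz_sa desc; pose sb := [seq y <- enum B | e x y] ++
  [seq y <- enum B | ~~ e x y].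
have pB : perm_eq sb (enum B) by rewrite perm_filterC.
have sz_sb : size sb = k by rewrite (perm_size pB) -cardE.
exists (x :: sa), sb; split=> //.
have const b : [seq e x y | y <- enum B & e x y == b]
             = nseq (count (fun y => e x y == b) (enum B)) b.
  by elim: (enum B) => //= y s IH; case: eqP => [/= ->|_]; rewrite IH.
have filterT b : [seq y <- enum B | (if b then id else negb) (e x y)]
    = [seq y <- enum B | e x y == b].
  by apply: eq_filter => y; case: b; case: (e x y).
have row0 : [seq e x y | y <- sb] = nseq (degree B x) true ++
    nseq (k - degree B x) false.
  have cT : count (fun y => e x y == true) (enum B) = degree B x.
    rewrite -(degree_perm _ (perm_refl _)) count_map.
    by apply: eq_count => y /=; case: (e x y).
  rewrite map_cat (filterT true) (filterT false) !const cT; congr (_ ++ nseq _ _).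
  rewrite -szB cardE -cT -(count_predC (fun y => e x y == true)) addKn.
  by apply: eq_count => y /=; case: (e x y).
rewrite /adjacency /= row0; apply: allpairs_f_dep.
  by rewrite mem_iota ltnS -szB degree_card.
have -> : k.-1 = size [seq [seq e z y | y <- sb] | z <- sa].
  by rewrite size_map -sz_sa.
rewrite -{1}sz_sb; apply: mem_descending.
  by apply/allP => _ /mapP[z _ ->]; rewrite size_map.
rewrite -map_comp (eq_map (g := degree B)) => [|z]; last exact: degree_perm.
by rewrite path_map.
Qed.

(** The greedy step: the vertices in [s] are too few to cover all neighbours of [x]. *)
Lemma new_neighbour (X : {set T}) x (s : seq T) :
  size s < degree X x -> exists y, [/\ y \in X, e x y & y \notin s].
Proof.
move=> lt_s; have [/exists_inP[y yX /andP[exy ys]]|none] :=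
  boolP [exists y in X, e x y && (y \notin s)]; first by exists y.
suff: degree X x <= size s by rewrite leqNgt lt_s.
apply: leq_trans (card_size s); rewrite -sum1_card [leqRHS]big_mkcond /degree.
rewrite [leqLHS]big_mkcond; apply: leq_sum => y _; case: ifP => // yX.
have := exists_inPn none y yX; rewrite negb_and negbK.
by case: (e x y) => //= ->.
Qed.

(** The lists in the [uniq] hypotheses are reversed to match the greedy choice, where each new
    vertex avoids those chosen before it. *)
Lemma hosts_intro (A B : {set T}) (p : rel nat) a0 a1 a2 b0 b1 b2 :
    [disjoint A & B] -> uniq [:: a2; a1; a0] -> uniq [:: b2; b1; b0] ->
    all [in A] [:: a0; a1; a2] -> all [in B] [:: b0; b1; b2] ->
    (forall i j, i < 3 -> j < 3 -> p i j ->
       e (nth a0 [:: a0; a1; a2] i) (nth a0 [:: b0; b1; b2] j)) ->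
  hosts e p.
Proof.
move=> dAB ua ub /allP aA /allP bB H.
exists (nth a0 [:: a0; a1; a2]), (nth a0 [:: b0; b1; b2]); split=> //.
change (uniq ([:: a0; a1; a2] ++ [:: b0; b1; b2])).
rewrite cat_uniq -rev_uniq ua -[uniq [:: b0; _; _]]rev_uniq ub andbT.
apply/hasPn => y /bB yB; apply/negP => /aA yA.
by have /pred0P/(_ y) := dAB; rewrite /= yA yB.
Qed.

(** * Greedy embeddings under minimum degree 3 *)

Section MinDegree3.

Variables A B : {set T}.
Hypothesis dAB : [disjoint A & B].
Hypothesis degA : {in A, forall x, 2 < degree B x}.
Hypothesis degB : {in B, forall y, 2 < degree A y}.

(** Walk along [a0 b0 a1 b1 a2 b2]: each new vertex has to avoid at most two earlier ones of its
    class. *)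
Lemma path6_min_degree3 : A != set0 -> hosts e path6.
Proof.
case/set0Pn=> a0 a0A.
have [b0 [b0B e00 _]] := @new_neighbour B a0 [::] (ltnW (ltnW (degA a0A))).
have [a1 [a1A e01 n1]] := @new_neighbour A b0 [:: a0] (ltnW (degB b0B)).
have [b1 [b1B e11 m1]] := @new_neighbour B a1 [:: b0] (ltnW (degA a1A)).
have [a2 [a2A e12 n2]] := @new_neighbour A b1 [:: a1; a0] (degB b1B).
have [b2 [b2B e22 m2]] := @new_neighbour B a2 [:: b1; b0] (degA a2A).
apply: (@hosts_intro A B _ a0 a1 a2 b0 b1 b2) => //=.
- by rewrite n2 n1.
- by rewrite m2 m1.
- by rewrite a0A a1A a2A.
- by rewrite b0B b1B b2B.
- by do 3?[case=> //]; do 3?[case=> //]; rewrite /= ?[e a1 b0]e_sym ?[e a2 b1]e_sym.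
Qed.

(** Take three neighbours of the centre [a0], then prolong the legs through [b0] and [b1]. *)
Lemma spider_min_degree3 : A != set0 -> hosts e spider.
Proof.
case/set0Pn=> a0 a0A.
have [b0 [b0B e00 _]] := @new_neighbour B a0 [::] (ltnW (ltnW (degA a0A))).
have [b1 [b1B e01 m1]] := @new_neighbour B a0 [:: b0] (ltnW (degA a0A)).
have [b2 [b2B e02 m2]] := @new_neighbour B a0 [:: b1; b0] (degA a0A).
have [a1 [a1A e10 n1]] := @new_neighbour A b0 [:: a0] (ltnW (degB b0B)).
have [a2 [a2A e21 n2]] := @new_neighbour A b1 [:: a1; a0] (degB b1B).
apply: (@hosts_intro A B _ a0 a1 a2 b0 b1 b2) => //=.
- by rewrite n2 n1.
- by rewrite m2 m1.
- by rewrite a0A a1A a2A.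
- by rewrite b0B b1B b2B.
- by do 3?[case=> //]; do 3?[case=> //]; rewrite /= ?[e a1 b0]e_sym ?[e a2 b1]e_sym.
Qed.

End MinDegree3.

Lemma double_star_edge (A B : {set T}) a0 b0 :
    [disjoint A & B] -> a0 \in A -> b0 \in B -> e a0 b0 ->
    2 < degree B a0 -> 2 < degree A b0 -> hosts e double_star.
Proof.
move=> dAB a0A b0B e00 dega degb.
have [b1 [b1B e01 m1]] := @new_neighbour B a0 [:: b0] (ltnW dega).
have [b2 [b2B e02 m2]] := @new_neighbour B a0 [:: b1; b0] dega.
have [a1 [a1A e10 n1]] := @new_neighbour A b0 [:: a0] (ltnW degb).
have [a2 [a2A e20 n2]] := @new_neighbour A b0 [:: a1; a0] degb.
apply: (@hosts_intro A B _ a0 a1 a2 b0 b1 b2) => //=.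
- by rewrite n2 n1.
- by rewrite m2 m1.
- by rewrite a0A a1A a2A.
- by rewrite b0B b1B b2B.
- by do 3?[case=> //]; do 3?[case=> //]; rewrite /= ?[e a1 b0]e_sym ?[e a2 b0]e_sym.
Qed.

(* [a] and [b] are the numbers of vertices of degree at least 3 on each side.
   Count the edges at the small vertices of [A], at most 2 each, then those at
   the large vertices of [A]: their other ends are small vertices of [B], which
   have at most [minn 2 a] large neighbours each. *)
Lemma light_edges_bound (A B : {set T}) :
    {in A & B, forall x y, e x y -> (degree B x <= 2) || (degree A y <= 2)} ->
  exists a b, [/\ a <= #|A|, b <= #|B|,
    between A B <= 2 * (#|A| - a) + minn 2 a * (#|B| - b)
    & between A B <= 2 * (#|B| - b) + minn 2 b * (#|A| - a)].
Proof.
have half (X Y : {set T}) (X3 := [set x in X | 2 < degree Y x])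
      (Y3 := [set y in Y | 2 < degree X y]) :
    {in X & Y, forall x y, e x y -> (degree Y x <= 2) || (degree X y <= 2)} ->
    between X Y <= 2 * (#|X| - #|X3|) + minn 2 #|X3| * (#|Y| - #|Y3|).
  move=> light.
  have sX : X3 \subset X by apply/subsetP => x; rewrite inE => /andP[].
  have sY : Y3 \subset Y by apply/subsetP => x; rewrite inE => /andP[].
  have split_in (U V W : {set T}) : V \subset U ->
      between U W = between V W + between (U :\: V) W.
    by move=> sVU; rewrite /between (big_setID V) /= (setIidPr sVU).
  have no33 : between Y3 X3 = 0.
    apply/eqP; rewrite sum_nat_eq0; apply/forall_inP => y; rewrite inE.
    case/andP=> yY dy; rewrite sum_nat_eq0; apply/forall_inP => x; rewrite inE.
    case/andP=> xX dx; rewrite eqb0; apply/negP; rewrite e_sym.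
    by move=> /(light x y xX yY)/orP[]; rewrite leqNgt ?dx ?dy.
  rewrite (split_in _ X3) // [between X3 Y]between_sym (split_in _ Y3) // no33.
  rewrite -!cardsDS // add0n addnC leq_add //.
    rewrite mulnC; apply: between_le => x; rewrite !inE => /andP[+ xX].
    by rewrite xX /= -leqNgt.
  rewrite mulnC; apply: between_le => y; rewrite !inE => /andP[+ yY].
  rewrite yY /= -leqNgt leq_min degree_card andbT; apply: leq_trans.
  by rewrite /degree [leqRHS](big_setID X3) /= (setIidPr sX) leq_addr.
move=> light; exists #|[set x in A | 2 < degree B x]|.
exists #|[set y in B | 2 < degree A y]|; split.
- by apply/subset_leq_card/subsetP => x; rewrite inE => /andP[].
- by apply/subset_leq_card/subsetP => x; rewrite inE => /andP[].
- exact: half.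
- by rewrite between_sym; apply: half => y x yB xA; rewrite e_sym orbC; apply: light.
Qed.

(** * Deleting vertices of low degree *)

Section Deletion.

(** [P] will be the presence of the path or of the spider; both go through the same induction. *)
Variable P : Prop.
Hypothesis base3 : forall A B : {set T}, [disjoint A & B] ->
  #|A| = 3 -> #|B| = 3 -> 6 < between A B -> P.
Hypothesis base4 : forall A B : {set T}, [disjoint A & B] ->
  #|A| = 4 -> #|B| = 4 -> 8 < between A B -> P.
Hypothesis min_degree3 : forall A B : {set T}, [disjoint A & B] ->
  {in A, forall x, 2 < degree B x} -> {in B, forall y, 2 < degree A y} ->
  A != set0 -> P.

Lemma disjoint_del (A B : {set T}) x : [disjoint A & B] -> [disjoint A :\ x & B].
Proof. exact/disjointWl/subsetDl. Qed.

(** Remove vertices of [B] one by one. One of degree at most 2 keeps the average above 2; if there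
    is none, any vertex may go, since all the others have degree at least 3. *)
Lemma shrink (A B : {set T}) k : 0 < k <= #|B| -> 2 * #|B| < between A B ->
  exists C : {set T}, [/\ C \subset B, #|C| = k & 2 * k < between A C].
Proof.
move: {2}(#|B| - k) (erefl (#|B| - k)) => d.
elim: d B => [|d IH] B dE /andP[k0 kB] dense; first by exists B; split=> //; lia.
have [y yB low] : exists2 y, y \in B & 2 * #|B :\ y| < between A (B :\ y).
  have [/exists_inP[y yB dy]|/exists_inPn high] :=
    boolP [exists y in B, degree A y <= 2].
    exists y => //; move: dense; rewrite (cardsD1 y) yB.
    by rewrite between_sym (between_del _ yB) between_sym; lia.
  have [y yB] : exists y, y \in B by apply/card_gt0P; lia.
  exists y => //; rewrite between_sym.
  have := @between_ge (B :\ y) A 3; have := cardsD1 y B; rewrite yB => cB H.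
  have/H : {in B :\ y, forall z, 3 <= degree A z}.
    by move=> z /setD1P[_ /high]; rewrite -ltnNge.
  lia.
have cB := cardsD1 y B; rewrite yB in cB.
have [||C [sC cC dC]] := IH (B :\ y) _ _ low; try lia.
by exists C; split=> //; apply: subset_trans sC (subsetDl _ _).
Qed.

Lemma dense3 (A B : {set T}) : [disjoint A & B] -> #|A| = 3 -> 3 <= #|B| ->
  2 * #|B| < between A B -> P.
Proof.
move=> dAB A3 B3 /(@shrink A B 3 B3)[C [sC cC dense]].
by apply: (base3 (A := A) (B := C)) => //; apply: disjointWr sC dAB.
Qed.

Lemma dense4 (A B : {set T}) : [disjoint A & B] -> #|A| = 4 -> 4 <= #|B| ->
  2 * #|B| < between A B -> P.
Proof.
move=> dAB A4 B4 /(@shrink A B 4 B4)[C [sC cC dense]].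
by apply: (base4 (A := A) (B := C)) => //; apply: disjointWr sC dAB.
Qed.

(** Induction on the order: while both sides exceed 4, deleting a vertex of degree at most 2
    preserves the hypotheses, and without such a vertex [min_degree3] applies. *)
Lemma dense_ge4 (A B : {set T}) : [disjoint A & B] -> 4 <= #|A| -> 4 <= #|B| ->
  2 * (#|A| + #|B|) - 8 < between A B -> P.
Proof.
move: {2}(#|A| + #|B|) (leqnn (#|A| + #|B|)) => s.
elim: s A B => [|s IH] A B sz dAB A4 B4 dense; first by lia.
(* For [#|A| = 4] the bound [2 * (#|A| + #|B|) - 8] is exactly [2 * #|B|]. *)
have [eA|nA] := eqVneq #|A| 4; first by apply: (dense4 dAB) => //; lia.
have [eB|nB] := eqVneq #|B| 4.
  by apply: (@dense4 B A); rewrite 1?disjoint_sym 1?between_sym //; lia.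
have [/exists_inP[x xA dx]|/exists_inPn highA] :=
    boolP [exists x in A, degree B x <= 2].
  have cA := cardsD1 x A; have bA := between_del B xA; rewrite xA in cA.
  by apply: (IH (A :\ x) B); rewrite ?disjoint_del //; lia.
have [/exists_inP[y yB dy]|/exists_inPn highB] :=
    boolP [exists y in B, degree A y <= 2].
  have cB := cardsD1 y B; have bB := between_del A yB; rewrite yB in cB.
  rewrite between_sym in dense; rewrite disjoint_sym in dAB.
  by apply: (IH (B :\ y) A); rewrite ?disjoint_del //; lia.
apply: (min_degree3 dAB).
- by move=> x /highA; rewrite -ltnNge.
- by move=> y /highB; rewrite -ltnNge.
- by rewrite -card_gt0; lia.
Qed.

End Deletion.

Definition extremal n m :=
  if (5 <= n) && (5 <= m) then 2 * (n + m) - 8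
  else if (n == 4) && (m == 4) then 9 else 2 * n.

(** For [#|B| = 3] the bound is [2 * #|A|]. Otherwise [extremal] equals [2 * (#|A| + #|B|) - 8],
    except that it is 9 instead of 8 on 4 + 4 vertices. *)
Lemma dense_extremal (P : Prop) (A B : {set T}) :
    (forall A B : {set T}, [disjoint A & B] ->
       #|A| = 3 -> #|B| = 3 -> 6 < between A B -> P) ->
    (forall A B : {set T}, [disjoint A & B] ->
       #|A| = 4 -> #|B| = 4 -> 8 < between A B -> P) ->
    (forall A B : {set T}, [disjoint A & B] ->
       {in A, forall x, 2 < degree B x} -> {in B, forall y, 2 < degree A y} ->
       A != set0 -> P) ->
    [disjoint A & B] -> 3 <= #|B| <= #|A| ->
  extremal #|A| #|B| < between A B -> P.
Proof.
rewrite /extremal => base3 base4 mindeg dAB szAB dense.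
have [eB|nB] := eqVneq #|B| 3.
  apply: (dense3 base3 (A := B) (B := A));
    rewrite 1?disjoint_sym 1?between_sym //; first by lia.
  by move: dense; rewrite eB andbF; case: ifP; lia.
apply: (dense_ge4 base4 mindeg dAB); try lia.
by apply: leq_ltn_trans dense; case: ifP => ?; [|case: ifP => ?]; lia.
Qed.

(** * The upper bound for each of the three trees *)

Lemma uniq_enums (A B : {set T}) sa sb :
  perm_eq sa (enum A) -> perm_eq sb (enum B) -> [disjoint A & B] ->
  uniq (sa ++ sb).
Proof.
move=> pA pB dAB; rewrite cat_uniq (perm_uniq pA) (perm_uniq pB) !enum_uniq.
rewrite andbT; apply/hasPn => x; rewrite (perm_mem pA) (perm_mem pB) !mem_enum.
by move=> xB; apply: contraTN dAB => xA; apply/pred0Pn; exists x; apply/andP.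
Qed.

Lemma small_path6 k (A B : {set T}) : 2 < k -> path6_check k ->
  [disjoint A & B] -> #|A| = k -> #|B| = k -> 2 * k < between A B ->
  hosts e path6.
Proof.
move=> k3 /allP check dAB Ak Bk dense.
have [sa [sb [pA pB nf]]] := normal_adjacency (ltnW (ltnW k3)) Ak Bk.
have sz_a : size sa = k by rewrite (perm_size pA) -cardE.
have sz_b : size sb = k by rewrite (perm_size pB) -cardE.
have /implyP := check _ nf; rewrite (weight_adjacency pA pB) => /(_ dense).
exact: (occurs_hosts k3 (uniq_enums pA pB dAB) sz_a sz_b).
Qed.

Lemma small_spider k (A B : {set T}) : 2 < k -> spider_check k ->
  [disjoint A & B] -> #|A| = k -> #|B| = k -> 2 * k < between A B ->
  hosts e spider.
Proof.
move=> k3 /allP check dAB Ak Bk dense.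
have [sa [sb [pA pB nf]]] := normal_adjacency (ltnW (ltnW k3)) Ak Bk.
have sz_a : size sa = k by rewrite (perm_size pA) -cardE.
have sz_b : size sb = k by rewrite (perm_size pB) -cardE.
have /implyP := check _ nf; rewrite (weight_adjacency pA pB) => /(_ dense).
have occ p := @occurs_hosts _ e _ _ _ p k3 (uniq_enums pA pB dAB) sz_a sz_b.
by case/orP=> /occ // /(hosts_flip e_sym).
Qed.

Lemma extremal_path6 (A B : {set T}) : [disjoint A & B] -> 3 <= #|B| <= #|A| ->
  extremal #|A| #|B| < between A B -> hosts e path6.
Proof.
apply: dense_extremal => C D dCD.
- exact: (@small_path6 3 C D isT path6_check3 dCD).
- exact: (@small_path6 4 C D isT path6_check4 dCD).
- exact: path6_min_degree3.
Qed.

Lemma extremal_spider (A B : {set T}) : [disjoint A & B] -> 3 <= #|B| <= #|A| ->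
  extremal #|A| #|B| < between A B -> hosts e spider.
Proof.
apply: dense_extremal => C D dCD.
- exact: (@small_spider 3 C D isT spider_check3 dCD).
- exact: (@small_spider 4 C D isT spider_check4 dCD).
- exact: spider_min_degree3.
Qed.

Lemma extremal_double_star (A B : {set T}) :
    [disjoint A & B] -> 3 <= #|B| <= #|A| ->
  extremal #|A| #|B| < between A B -> hosts e double_star.
Proof.
move=> dAB szAB.
have [/exists_inP[x xA /exists_inP[y yB /and3P[exy dx dy]]] _|/exists_inPn none] :=
    boolP [exists x in A, exists y in B,
      [&& e x y, 2 < degree B x & 2 < degree A y]].
  exact: double_star_edge dAB xA yB exy dx dy.
have /light_edges_bound[a [b [aA bB]]] :
    {in A & B, forall x y, e x y -> (degree B x <= 2) || (degree A y <= 2)}.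
  move=> x y xA yB exy; have /exists_inPn/(_ y yB) := none x xA.
  by rewrite exy /= negb_and -!leqNgt.
have min2 k : minn 2 k.+2 = 2 by lia.
have [min0 min1] : minn 2 0 = 0 /\ minn 2 1 = 1 by [].
(* Splitting [a] and [b] into 0, 1 and at least 2 makes both bounds linear. The exceptional 9 comes
   from [a = b = 1] on 4 + 4 vertices: 2 * 3 + 3. *)
rewrite /extremal; case: a aA => [|[|a]] aA; case: b bB => [|[|b]] bB;
  rewrite ?(min2, min0, min1); (case: ifP => ?; [|case: ifP => ?]);
  lia.
Qed.

End Dense.

(** * Edge sets and the extremal graphs *)

(** As [U] and [V] are disjoint, an edge has exactly one orientation from [U] to [V]. *)
Lemma card_edges (G : sgraph) (U V : {set G}) :
  bipartition U V -> #|edges G| = between (@edge G) U V.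
Proof.
move=> [_ dUV bip].
pose S := [set p : G * G | [&& p.1 \in U, p.2 \in V & edge p.1 p.2]].
have notV x : x \in U -> x \in V -> False.
  by move=> xU xV; have /pred0P/(_ x) := dUV; rewrite /= xU xV.
have -> : edges G = [set [set p.1; p.2] | p in S].
  apply/setP => s; rewrite inE; apply/existsP/imsetP.
    case=> x /existsP[y /andP[exy /eqP->]]; case: (bip x y exy) => -[xU yV].
      by exists (x, y); rewrite // inE xU yV.
    by exists (y, x); rewrite /= 1?setUC // inE yV xU edge_sym.
  case=> -[x y]; rewrite inE => /and3P[_ _ exy] ->.
  by exists x; apply/existsP; exists y; rewrite exy eqxx.
rewrite card_in_imset => [|[x y] [x' y']].
  rewrite /between /degree pair_big -sum1_card [LHS]big_mkcond [RHS]big_mkcond.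
  apply: eq_bigr => -[x y] _; rewrite inE /=.
  by case: (x \in U); case: (y \in V); case: (edge x y).
rewrite !inE /= => /and3P[xU yV _] /and3P[x'U y'V _] /setP eq_s.
have /esym := eq_s x; have /esym := eq_s y; rewrite !inE !eqxx orbT /=.
case/orP=> /eqP yE; first by case: (notV y); rewrite // yE.
case/orP=> /eqP xE; last by case: (notV x); rewrite // xE.
by rewrite xE yE.
Qed.

(** * Bipartite graphs given by a relation on indices *)

Definition bigraph_edge (n m : nat) (r : rel nat) : rel ('I_n + 'I_m) :=
  fun x y => match x, y with
    | inl i, inr j | inr j, inl i => r i j
    | _, _ => false
  end.

Lemma bigraph_sym n m r : symmetric (@bigraph_edge n m r).
Proof. by case=> i [] j. Qed.

Lemma bigraph_irr n m r : irreflexive (@bigraph_edge n m r).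
Proof. by case. Qed.

Definition bigraph n m r := SGraph (@bigraph_sym n m r) (@bigraph_irr n m r).

Definition left_side n m : {set 'I_n + 'I_m} :=
  [set x | if x is inl _ then true else false].

Lemma bigraph_bipartition n m r :
  @bipartition (bigraph n m r) (left_side n m) (~: left_side n m).
Proof.
split; first by rewrite setUCr.
  by rewrite -setI_eq0 setICr.
by move=> [] i [] j //=; rewrite !inE; auto.
Qed.

Lemma bigraph_bipartite n m r : bipartite_graph n m (bigraph n m r).
Proof.
exists (left_side n m), (~: left_side n m); split.
- exact: bigraph_bipartition.
- rewrite -sum1_card big_mkcond big_sumType /=.
  rewrite [X in _ + X]big1 => [|j _]; last by rewrite inE.
  by rewrite addn0 (eq_bigr (fun=> 1)) ?sum1_card ?card_ord // => i _; rewrite inE.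
- rewrite -sum1_card big_mkcond big_sumType /=.
  rewrite [X in X + _]big1 => [|j _]; last by rewrite !inE.
  by rewrite (eq_bigr (fun=> 1)) ?sum1_card ?card_ord // => i _; rewrite !inE.
Qed.

Lemma card_bigraph n m r :
  #|edges (bigraph n m r)| = \sum_(i < n) \sum_(j < m) r i j.
Proof.
rewrite (card_edges (bigraph_bipartition n m r)) /between /degree.
rewrite big_mkcond big_sumType /= [X in _ + X]big1 => [|j _]; last by rewrite inE.
rewrite addn0; apply: eq_bigr => i _; rewrite inE.
rewrite big_mkcond big_sumType /= big1 => [|j _]; last by rewrite !inE.
by apply: eq_bigr => j _; rewrite !inE.
Qed.

(* The double star as a graph: [(s, None)] are the two centres, and
   [(s, Some b)] the two leaves attached to [(s, None)]. *)
Definition star_edge : rel (bool * option bool) := fun x y =>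
  match x, y with
  | (s, None), (t, None) => s != t
  | (s, None), (t, Some _) | (s, Some _), (t, None) => s == t
  | _, _ => false
  end.

Lemma star_sym : symmetric star_edge.
Proof. by move=> [[] [[]|]] [[] [[]|]]. Qed.

Lemma star_irr : irreflexive star_edge.
Proof. by move=> [[] [[]|]]. Qed.

Definition star_graph := SGraph star_sym star_irr.

Lemma star_connected : connected star_graph.
Proof.
have sym := sym_connect_sym star_sym.
split; first by rewrite card_prod card_option !card_bool.
have centre s t : connect star_edge (s, None) (t, None).
  by have [->|st] := eqVneq s t; [apply: connect0 | apply: connect1].
have toc (x : bool * option bool) s : connect star_edge x (s, None).
  case: x => t [b|] //; apply: connect_trans (centre t s).
  by apply: connect1; rewrite /= eqxx.
by move=> x y; apply: connect_trans (toc x true) _; rewrite /= sym.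
Qed.

(* Each vertex of a cycle has two distinct neighbours on it, so a cycle avoids
   the leaves; but then at most the two centres are left. *)
Lemma star_acyclic : acyclic star_graph.
Proof.
move=> c sz /andP[cyc uc].
have noleaf s b : (s, Some b) \notin c.
  apply/negP => /rot_to[i c' cE].
  have := cyc; have := uc; rewrite -(rot_uniq i) -(rot_cycle i) cE.
  have: 2 < size (rot i c) by rewrite size_rot.
  rewrite cE; case: c' {cE} => [|y c'] //; case: (lastP c') => // {}c' z _.
  rewrite /= !rcons_path last_rcons rcons_uniq => /andP[_ /andP[yc _]].
  case/andP=> ey /andP[_ ez].
  have nb w : star_edge (s, Some b) w -> w = (s, None).
    by case: w => t [] //= /eqP->.
  move: yc; rewrite (nb y ey) (nb z) ?mem_rcons ?inE ?eqxx //.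
  by rewrite star_sym.
have sub : {subset c <= [:: (true, None); (false, None)]}.
  by move=> [s [b|]] xc; [rewrite (negbTE (noleaf s b)) in xc | case: s {xc}].
by have := uniq_leq_size uc sub; rewrite leqNgt sz.
Qed.

Lemma star_T33 : T33 star_graph.
Proof.
split; first by split; [apply: star_connected | apply: star_acyclic].
  by rewrite card_prod card_option !card_bool.
pose U : {set star_graph} :=
  [set x : bool * option bool | if x.2 is Some _ then ~~ x.1 else x.1].
exists U, (~: U).
have U3 : #|U| = 3.
  rewrite (_ : U = [set:: [:: (true, None); (false, Some true);
                              (false, Some false)]]).
    by apply/eqP; rewrite cardsE; apply/eqP/card_uniqP.
  by apply/setP => -[[] [[]|]]; rewrite !inE.
split=> //.
  split; [exact: setUCr | by rewrite -setI_eq0 setICr |].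
  by move=> [[] [[]|]] [[] [[]|]] //= _; rewrite !inE; auto.
by have := cardsC U; rewrite U3 card_prod card_option !card_bool; lia.
Qed.

Lemma contains_star (G : sgraph) : contains G star_graph ->
  exists x x1 x2 y y1 y2 : G, [/\ uniq [:: x; x1; x2; y; y1; y2], edge x y,
    edge x x1 /\ edge x x2 & edge y y1 /\ edge y y2].
Proof.
move=> [f [inj H]].
exists (f (true, None)), (f (true, Some true)), (f (true, Some false)).
exists (f (false, None)), (f (false, Some true)), (f (false, Some false)).
split; try by [apply: H | split; apply: H].
by rewrite (map_inj_uniq inj [:: _; _; _; _; _; _]).
Qed.

(** Adjacency determines the sides of all six vertices once the side of the first centre is known;
    the two cases differ by exchanging the centres. *)
Lemma bigraph_star_free n m (r : rel nat) :
    (forall i i1 i2 j j1 j2, [/\ i < n, i1 < n & i2 < n] ->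
       [/\ j < m, j1 < m & j2 < m] -> uniq [:: i; i1; i2] ->
       uniq [:: j; j1; j2] -> r i j -> r i j1 -> r i j2 -> r i1 j -> r i2 j ->
       False) ->
  ~ contains_all_T33 (bigraph n m r).
Proof.
move=> H /(_ _ star_T33)/contains_star[x [x1 [x2 [y [y1 [y2]]]]]].
case=> + exy [ex1 ex2] [ey1 ey2].
have inlK (i k : 'I_n) : (inl i == inl k :> 'I_n + 'I_m) = (i == k :> nat) by [].
have inrK (i k : 'I_m) : (inr i == inr k :> 'I_n + 'I_m) = (i == k :> nat) by [].
case: x x1 x2 y y1 y2 exy ex1 ex2 ey1 ey2 =>
  i [] j1 [] j2 [] j [] i1 [] i2 //= r0 r1 r2 r3 r4;
  rewrite !inE !(inlK, inrK) /= => u.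
  by apply: (H i i1 i2 j j1 j2); rewrite /= ?inE //; lia.
by apply: (H j j1 j2 i i1 i2); rewrite /= ?inE //; lia.
Qed.

(** The disjoint union of K_{2,m-2} and K_{n-2,2}. *)
Definition two_bicliques (i j : nat) := (i < 2) (+) (j < 2).
Definition biclique2 (i j : nat) := j < 2.
(** The claws are centred at the vertex 0 of each side; [i == j] is the matching of their leaves. *)
Definition two_claws (i j : nat) :=
  (i == 0) (+) (j == 0) || (i == j) && (i != 0).

Lemma sum_two_bicliques n m : 2 <= n -> 2 <= m ->
  \sum_(i < n) \sum_(j < m) two_bicliques i j = 2 * (n + m) - 8.
Proof.
case: n => [|[|n]] // _; case: m => [|[|m]] // _.
have row (i : 'I_n.+2) :
    \sum_(j < m.+2) two_bicliques i j = if i < 2 then m else 2.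
  rewrite 2!big_ord_recl /two_bicliques; case: ifP => _ /=.
    by rewrite (eq_bigr (fun=> 1)) // sum1_card card_ord.
  by rewrite big1.
rewrite (eq_bigr _ (fun i _ => row i)) 2!big_ord_recl /=.
by rewrite (eq_bigr (fun=> 2)) // sum_nat_const card_ord; lia.
Qed.

Lemma sum_biclique2 n m : 2 <= m ->
  \sum_(i < n) \sum_(j < m) biclique2 i j = 2 * n.
Proof.
case: m => [|[|m]] // _; rewrite (eq_bigr (fun=> 2)) => [|i _].
  by rewrite sum_nat_const card_ord mulnC.
by rewrite 2!big_ord_recl /= big1.
Qed.

Lemma sum_two_claws : \sum_(i < 4) \sum_(j < 4) two_claws i j = 9.
Proof. by rewrite !(big_ord_recl, big_ord0). Qed.

Lemma extremal_attained n m : m <= n -> 3 <= m -> exists r : rel nat,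
  ~ contains_all_T33 (bigraph n m r) /\
  \sum_(i < n) \sum_(j < m) r i j = extremal n m.
Proof.
move=> le_mn m3; rewrite /extremal; case: ifP => [/andP[n5 m5]|_].
  exists two_bicliques; split; last by apply: sum_two_bicliques; lia.
  apply: bigraph_star_free => i i1 i2 j j1 j2 _ _ /=.
  (* Either [i], [i1], [i2] or [j], [j1], [j2] would be three distinct numbers below 2. *)
  by rewrite /two_bicliques !inE; lia.
case: ifP => [/andP[/eqP-> /eqP->]|_].
  exists two_claws; split; last exact: sum_two_claws.
  (* A vertex other than 0 has at most two neighbours, and the two vertices 0 are not adjacent, so
     one centre of a double star would lack a third neighbour. *)
  have nb i j : two_claws i.+1 j -> j = 0 \/ j = i.+1.
    by rewrite /two_claws /= andbT => /orP[]/eqP; auto.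
  have nb' i j : two_claws i j.+1 -> i = 0 \/ i = j.+1.
    by case: i => [|i]; [left | rewrite /two_claws /= andbT => /eqP; auto].
  apply: bigraph_star_free => [[|i] i1 i2 [|j] j1 j2] _ _ ui uj //.
    by move=> _ _ _ /nb' h1 /nb' h2; move: ui; rewrite /= !inE; lia.
  - by move=> /nb h /nb h1 /nb h2; move: uj; rewrite /= !inE; lia.
  - by move=> /nb h /nb h1 /nb h2; move: uj; rewrite /= !inE; lia.
exists biclique2; split; last by apply: sum_biclique2; lia.
apply: bigraph_star_free => i i1 i2 j j1 j2 _ _ /=.
by rewrite /biclique2 !inE; lia.
Qed.

Theorem theorem1p8 (n m : nat) (le_mn : m <= n) (ge3_m : 3 <= m) :
  is_ex n m
    (if (5 <= n) && (5 <= m) then 2 * (n + m) - 8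
     else if (n == 4) && (m == 4) then 9
     else 2 * n).
Proof.
rewrite -/(extremal n m); split.
  have [r [free count_r]] := extremal_attained le_mn ge3_m.
  exists (bigraph n m r); split=> //; first exact: bigraph_bipartite.
  by rewrite card_bigraph.
move=> G [U [V [bip Un Vm]]] free; rewrite (card_edges bip).
have [_ dUV _] := bip; have sz : 3 <= #|V| <= #|U| by rewrite Un Vm ge3_m.
(* One edge too many forces all three patterns, hence every tree of T_{3,3}, against [free]. *)
rewrite leqNgt; apply/negP; rewrite -Un -Vm => dense.
apply: free => T /T33_fitted[] /fitted_contains; apply.
- exact: (extremal_path6 (@edge_sym G) dUV sz).
- exact: (extremal_double_star (@edge_sym G) dUV sz).
- exact: (extremal_spider (@edge_sym G) dUV sz).
Qed.
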